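(* Consider a sequence of instances of the model below indexed by $n\to\infty$, where $G=G_n$ is an arbitrary (deterministic) graph on $n$ vertices with average degree $d=d_n$ and $\varepsilon=\varepsilon_n\in(0,1/2)$ may depend on $n$. Let $0<\tau<2/3$ be fixed and assume $d\le n^{\tau}$. If exact recovery with high probability is possible, then $$\frac{d}{\log n}\ \ge\ \frac{1-3\tau/2}{D(1/2\,\|\,\varepsilon)}-\frac{1}{\log n}+o\!\left(\frac{1}{D(1/2\,\|\,\varepsilon)}\right).$$ In particular, if $\varepsilon\to 1/2$, this necessary condition implies $$\frac{d}{\log n}\ \ge\ \frac{2(1-3\tau/2)}{(1-2\varepsilon)^2}+o\!\left(\frac{1}{(1-2\varepsilon)^2}\right).$$
   Context: Model: $G=(V,E)$ is a simple undirected graph with $V=[n]$, $m=|E|$, and incidence matrix $B_G\in\{0,1\}^{m\times n}$ ($B_G(e,v)=1$ iff edge $e$ is incident to vertex $v$). An unknown vector $x\in\{0,1\}^n$ (uniform prior) is observed through $Y=B_G x\oplus Z\in\{0,1\}^m$, i.e. $Y_{(i,j)}=x_i\oplus x_j\oplus Z_{(i,j)}$, where all arithmetic is modulo 2 and $Z$ has i.i.d. Bernoulli$(\varepsilon)$ entries, $\varepsilon\in[0,1/2]$. Exact recovery with high probability means there is a decoder (equivalently, the maximum-likelihood decoder) which, from $Y$ (and knowledge of $G,\varepsilon$), outputs an element of $\{x,\ x\oplus 1^n\}$ with probability tending to $1$ as $n\to\infty$. The average degree is $d=2|E|/n$. All logarithms are natural, and $D(1/2\,\|\,\varepsilon)=\tfrac12\log\frac{1}{2\varepsilon}+\tfrac12\log\frac{1}{2(1-\varepsilon)}$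 is the Kullback–Leibler divergence between Bernoulli$(1/2)$ and Bernoulli$(\varepsilon)$. *)

(* Defs.v *)
From mathcomp Require Import all_boot.
From Stdlib Require Import Reals.

Set Implicit Arguments.
Unset Strict Implicit.
Unset Printing Implicit Defensive.

(* A simple undirected graph on V = [n] = 'I_n is a symmetric irreflexive
   relation.  Its edges are listed once each, as pairs (i,j) with i < j. *)
Definition simple_graph (n : nat) (G : rel 'I_n) : Prop :=
  (forall i j, G i j = G j i) /\ (forall i, G i i = false).

Definition edge (n : nat) (G : rel 'I_n) : Type :=
  {p : 'I_n * 'I_n | (p.1 < p.2)%N && G p.1 p.2}.

Definition num_edges (n : nat) (G : rel 'I_n) : nat := #|{: edge G}|.

Definition avg_degree (n : nat) (G : rel 'I_n) : R :=
  (2 * INR (num_edges G) / INR n)%R.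

Definition observe (n : nat) (G : rel 'I_n) (x : {ffun 'I_n -> bool})
  (z : {ffun edge G -> bool}) : {ffun edge G -> bool} :=
  [ffun e => (x (sval e).1 (+) x (sval e).2) (+) z e].

Definition flip_all (n : nat) (x : {ffun 'I_n -> bool}) : {ffun 'I_n -> bool} :=
  [ffun i => ~~ x i].

(* Probability that the decoder [dec] outputs x or x (+) 1^n, when x is
   uniform on {0,1}^n and Z has i.i.d. Bernoulli(eps) entries. *)
Definition success_prob (n : nat) (G : rel 'I_n) (eps : R)
  (dec : {ffun edge G -> bool} -> {ffun 'I_n -> bool}) : R :=
  \big[Rplus/0%R]_(x : {ffun 'I_n -> bool})
   \big[Rplus/0%R]_(z : {ffun edge G -> bool})
     ((/ 2) ^ n *
      \big[Rmult/1%R]_(e : edge G) (if z e then eps else 1 - eps) *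
      (if (dec (observe x z) == x) || (dec (observe x z) == flip_all x)
       then 1 else 0))%R.

Definition KL_half (eps : R) : R :=
  (/ 2 * ln (/ (2 * eps)) + / 2 * ln (/ (2 * (1 - eps))))%R.

Definition exact_recovery_whp (G : forall n : nat, rel 'I_n) (eps : nat -> R) : Prop :=
  exists dec : forall n : nat, {ffun edge (G n) -> bool} -> {ffun 'I_n -> bool},
    Un_cv (fun n => success_prob (eps n) (dec n)) 1%R.

(* Main.v *)
(** Fix an independent set S of vertices and reveal x outside S.  Each v in S is
    then decoded from its own deg(v) edges only, and independently of the other
    vertices of S, so the success probability is at most
    2 * prod_(v in S) (1 - t_v / 2), where t_v is the probability that exactly
    half (rounded up) of the edges at v are noisy and the factor 2 accounts for
    the global flip.  The central binomial coefficient gives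
    t_v >= exp (- (deg v + 1) D) / O(sqrt (deg v + 1)).  By Markov's inequality a
    constant fraction of the vertices satisfies deg v + 1 <= K := (1 + eta)(d + 1),
    and a maximal independent set among them has size of order n / K.  Success
    therefore forces n K^(-3/2) exp (- K D) = O(1), and d <= n^tau turns
    the exponent 3/2 into the loss 3 tau / 2. *)
Require Import Defs.
From Stdlib Require Import Reals.
From mathcomp Require Import reals topology sequences exp.
From mathcomp Require Import Rstruct_topology.
From mathcomp Require Import all_boot all_order all_algebra.
From mathcomp Require Import lra ring.

Set Implicit Arguments.
Unset Strict Implicit.
Unset Printing Implicit Defensive.

Import Order.TTheory GRing.Theory Num.Theory.

Local Open Scope ring_scope.

Section ProductLaw.
Variables (R : comNzRingType) (E T : finType) (p : E -> T -> R).
Hypothesis p_sum1 : forall e, \sum_t p e t = 1.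
Implicit Types (y z : {ffun E -> T}) (A : {set E}) (F H : {ffun E -> T} -> R).

Definition product_law z : R := \prod_e p e (z e).

Definition expectation F : R := \sum_z product_law z * F z.

Lemma product_law_family A (t : E -> T) :
  \sum_(z in family (fun e => if e \in A then pred1 (t e) else predT))
    product_law z = \prod_(e in A) p e (t e).
Proof.
rewrite -bigA_distr_big_dep [RHS]big_mkcond; apply: eq_bigr => e _.
by case: (e \in A); rewrite ?big_pred1_eq ?p_sum1.
Qed.

Lemma sum_product_law : \sum_z product_law z = 1.
Proof. by rewrite -bigA_distr_bigA big1. Qed.

Lemma expectation1 : expectation (fun=> 1) = 1.
Proof.
by rewrite -[RHS]sum_product_law; apply: eq_bigr => z _; rewrite mulr1.
Qed.

Lemma expectationD F H :
  expectation (fun z => F z + H z) = expectation F + expectation H.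
Proof.
by rewrite /expectation -big_split; apply: eq_bigr => z _; rewrite mulrDr.
Qed.

Definition depends_on A F := forall y z, {in A, y =1 z} -> F y = F z.

Definition splice A y z : {ffun E -> T} :=
  [ffun e => if e \in A then y e else z e].

Lemma product_law_splice A y z :
  product_law (splice A y z) * product_law (splice A z y) =
  product_law y * product_law z.
Proof.
rewrite -!big_split; apply: eq_bigr => e _ /=; rewrite !ffunE.
by case: (e \in A) => //; rewrite mulrC.
Qed.

(* Exchanging the coordinates outside A of two independent copies preserves
   their joint law. *)
Lemma expectation_indep A F H :
  depends_on A F -> depends_on (~: A) H ->
  expectation (fun z => F z * H z) = expectation F * expectation H.
Proof.
move=> dF dH; rewrite -[LHS]mulr1 -[X in _ * X]expectation1.
rewrite !big_distrlr /= !pair_big.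
pose swap (yz : {ffun E -> T} * {ffun E -> T}) :=
  (splice A yz.1 yz.2, splice A yz.2 yz.1).
have swapK : involutive swap.
  by case=> y z; congr pair; apply/ffunP => e; rewrite !ffunE /=; case: (e \in A).
rewrite (reindex_inj (inv_inj swapK)); apply: eq_bigr => -[y z] _ /=.
rewrite (dF (splice A y z) y) => [|e eA]; last by rewrite ffunE eA.
rewrite (dH (splice A y z) z) => [|e]; last by rewrite inE ffunE => /negbTE->.
by rewrite mulr1 mulrAC product_law_splice mulrACA.
Qed.

Lemma expectation_prod (I : finType) (S : {set I}) (D : I -> {set E})
    (F : I -> {ffun E -> T} -> R) :
  {in S &, forall i j, i != j -> [disjoint D i & D j]} ->
  (forall i, depends_on (D i) (F i)) ->
  expectation (fun z => \prod_(i in S) F i z) = \prod_(i in S) expectation (F i).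
Proof.
move=> dis dF; rewrite -[RHS]big_enum.
transitivity (expectation (fun z => \prod_(i <- enum S) F i z)).
  by apply: eq_bigr => z _; rewrite big_enum.
have: pairwise (fun i j => [disjoint D i & D j]) (enum S).
  apply: (sub_in_pairwise dis); last by rewrite -uniq_pairwise enum_uniq.
  by apply/allP => i; rewrite mem_enum.
elim: (enum S) => [|i s IHs] /=.
  rewrite big_nil -[RHS]expectation1 => _.
  by apply: eq_bigr => z _; rewrite big_nil.
case/andP=> /allP disi /IHs; rewrite big_cons => <-.
rewrite -(@expectation_indep (D i)) //.
  by apply: eq_bigr => z _; rewrite big_cons.
move=> y z yz; rewrite !big_seq; apply: eq_bigr => j js; apply: dF => e eDj.
by apply: yz; rewrite inE (disjointFl (disi j js)).
Qed.

End ProductLaw.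

Section BernoulliNoise.
Variables (R : realFieldType) (E : finType) (eps : R).
Implicit Types (z : {ffun E -> bool}) (A : {set E}).

Definition noise (e : E) (b : bool) : R := if b then eps else 1 - eps.

Definition flip A z : {ffun E -> bool} := [ffun e => (e \in A) (+) z e].

Definition ones A z : {set E} := [set e in A | z e].

Definition likelihood_ratio A z : R :=
  \prod_(e in A) (noise e (~~ z e) / noise e (z e)).

Definition flip_gain A z : R := Num.max 1 (likelihood_ratio A z).

Definition tie_prob (k : nat) : R :=
  (eps ^+ uphalf k * (1 - eps) ^+ (k - uphalf k)) *+ 'C(k, uphalf k).

Lemma sum_noise e : \sum_b noise e b = 1.
Proof. by rewrite big_bool /= addrC subrK. Qed.

Lemma flipK A : involutive (flip A).
Proof. by move=> z; apply/ffunP => e; rewrite !ffunE addKb. Qed.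

Lemma ones_sub A z : ones A z \subset A.
Proof. by apply/subsetP => e /setIdP[]. Qed.

Lemma ones_eqE A (B : {set E}) z : B \subset A ->
  (ones A z == B) =
  (z \in family (fun e => if e \in A then pred1 (e \in B) else predT)).
Proof.
move=> /subsetP BA; apply/eqP/familyP => [<- e|zB].
  by rewrite inE; case: (e \in A) => /=; rewrite ?inE.
apply/setP => e; have := zB e; rewrite inE.
by case: (boolP (e \in A)) => [_ /eqP|/(contra (BA e))/negbTE].
Qed.

Lemma product_law_ones A (B : {set E}) : B \subset A ->
  \sum_(z | ones A z == B) product_law noise z =
  eps ^+ #|B| * (1 - eps) ^+ (#|A| - #|B|).
Proof.
move=> BA; rewrite (eq_bigl _ _ (fun z => ones_eqE z BA)).
rewrite product_law_family; last exact: sum_noise.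
rewrite -cardsDS // (big_setID B) /= (setIidPr BA) -!prodr_const.
congr (_ * _); apply: eq_bigr => e; first by move=> ->.
by case/setDP=> _ /negbTE ->.
Qed.

Lemma prob_card_ones A m :
  expectation noise (fun z => (#|ones A z| == m)%:R) =
  (eps ^+ m * (1 - eps) ^+ (#|A| - m)) *+ 'C(#|A|, m).
Proof.
transitivity (\sum_(z | #|ones A z| == m) product_law noise z).
  by rewrite [RHS]big_mkcond; apply: eq_bigr => z _; rewrite mulr_natr mulrb.
pose draws := [set B : {set E} | B \subset A & #|B| == m].
rewrite (partition_big (ones A) [in draws]) /= => [|z]; last first.
  by rewrite inE ones_sub.
rewrite -cards_draws -sumr_const; apply: eq_bigr => B.
rewrite inE => /andP[BA /eqP Bm]; rewrite -[in RHS]Bm -product_law_ones //.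
by apply: eq_bigl => z; case: (ones A z =P B) => [->|_]; rewrite ?Bm ?eqxx ?andbF.
Qed.

Hypothesis eps01 : 0 < eps < 1.

Lemma noise_gt0 e b : 0 < noise e b.
Proof. by case: b; rewrite /= ?subr_gt0; case/andP: eps01. Qed.

Lemma product_law_noise_gt0 z : 0 < product_law noise z.
Proof. by apply: prodr_gt0 => e _; apply: noise_gt0. Qed.

Lemma expectation_le (F H : {ffun E -> bool} -> R) :
  (forall z, F z <= H z) -> expectation noise F <= expectation noise H.
Proof.
by move=> FH; apply: ler_sum => z _; rewrite ler_pM2l ?product_law_noise_gt0.
Qed.

Lemma likelihood_ratio_gt0 A z : 0 < likelihood_ratio A z.
Proof. by apply: prodr_gt0 => e _; rewrite divr_gt0 ?noise_gt0. Qed.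

Lemma product_law_flip A z :
  product_law noise (flip A z) = product_law noise z * likelihood_ratio A z.
Proof.
rewrite /likelihood_ratio [X in _ * X]big_mkcond -big_split.
apply: eq_bigr => e _ /=; rewrite ffunE; case: (e \in A); rewrite ?mulr1 //.
by rewrite addTb mulrC divfK ?gt_eqF ?noise_gt0.
Qed.

Lemma expectation_likelihood_ratio A : expectation noise (likelihood_ratio A) = 1.
Proof.
rewrite -(sum_product_law sum_noise) (reindex_inj (inv_inj (flipK A))).
by apply: eq_bigr => z _; rewrite product_law_flip.
Qed.

Lemma likelihood_ratio_bigcup (I : finType) (S : {set I}) (D : I -> {set E}) z :
  {in S &, forall i j, i != j -> [disjoint D i & D j]} ->
  likelihood_ratio (\bigcup_(i in S) D i) z =
  \prod_(i in S) likelihood_ratio (D i) z.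
Proof.
move=> dis; rewrite [\bigcup_(_ in _) _]big_mkcond [RHS]big_mkcond.
rewrite /likelihood_ratio partition_disjoint_bigcup => [|i j ij].
  by apply: eq_bigr => i _; case: ifP => _ //; rewrite big_set0.
case: ifP => iS; last by rewrite -setI_eq0 set0I.
by case: ifP => jS; [exact: dis | rewrite -setI_eq0 setI0].
Qed.

Lemma likelihood_ratioE A z : likelihood_ratio A z =
  ((1 - eps) / eps) ^+ #|ones A z| / ((1 - eps) / eps) ^+ (#|A| - #|ones A z|).
Proof.
rewrite -cardsDS ?ones_sub // /likelihood_ratio (big_setID (ones A z)) /=.
rewrite (setIidPr (ones_sub A z)) -!prodr_const -prodfV; congr (_ * _).
  by apply: eq_bigr => e; rewrite inE => /andP[_ ->].
apply: eq_bigr => e /setDP[eA]; rewrite inE eA /= => /negbTE ->.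
by rewrite invf_div.
Qed.

Hypothesis eps_half : eps <= 2^-1.

Lemma likelihood_ratio_ge1 A z :
  (#|A| <= #|ones A z|.*2)%N -> 1 <= likelihood_ratio A z.
Proof.
have /andP[eps0 eps1] := eps01.
have odds1 : 1 <= (1 - eps) / eps.
  by rewrite ler_pdivlMr // mul1r; move: eps_half; lra.
have odds0 := lt_le_trans ltr01 odds1.
move=> majority; rewrite likelihood_ratioE ler_pdivlMr ?exprn_gt0 //.
by rewrite mul1r ler_weXn2l // leq_subLR addnn.
Qed.

(* max(1, r) + min(1, r) = 1 + r, where min(1, r) is 1 on ties. *)
Lemma expectation_flip_gain_le A :
  expectation noise (flip_gain A) <= 2 - tie_prob #|A|.
Proof.
rewrite lerBrDr /tie_prob -prob_card_ones.
have -> : 2 = expectation noise (fun=> 1) +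
              expectation noise (likelihood_ratio A).
  by rewrite expectation_likelihood_ratio (expectation1 sum_noise).
rewrite -!expectationD; apply: expectation_le => z.
rewrite -[leRHS]addr_max_min lerD2l; case: eqP => [tie|_]; last first.
  by rewrite le_min ler01 ltW ?likelihood_ratio_gt0.
by rewrite mulr1n le_min lexx likelihood_ratio_ge1 // tie uphalfK leq_addl.
Qed.

Lemma expectation_flip_gain_ge1 A : 1 <= expectation noise (flip_gain A).
Proof.
rewrite -[leLHS](expectation1 sum_noise); apply: expectation_le => z.
by rewrite le_max lexx.
Qed.

End BernoulliNoise.

Lemma tie_prob_le1 (R : realFieldType) (eps : R) k : 0 < eps < 1 ->
  tie_prob eps k <= 1.
Proof.
move=> eps01; rewrite -[k]card_ord -cardsT /tie_prob -prob_card_ones.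
rewrite -[leRHS](expectation1 (@sum_noise R 'I_k eps)).
apply: expectation_le => // z.
by rewrite lern1 leq_b1.
Qed.

(** * Decoding on an independent set *)

Section IndependentSets.
Variables (n : nat) (G : rel 'I_n).
Implicit Types (x : {ffun 'I_n -> bool}) (y z w : {ffun edge G -> bool}).
Implicit Types (S : {set 'I_n}).

Definition star (v : 'I_n) : {set edge G} :=
  [set e : edge G | v \in [set (sval e).1; (sval e).2]].

Definition independent S : bool :=
  [forall e : edge G, ~~ (((sval e).1 \in S) && ((sval e).2 \in S))].

Definition erase S x : {ffun 'I_n -> bool} := [ffun v => (v \notin S) && x v].

Lemma edge_neq (e : edge G) : (sval e).1 != (sval e).2.
Proof. by case: e => -[i j] /= /andP[ij _]; rewrite neq_ltn ij. Qed.

Lemma in_bigcup_star S (e : edge G) :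
  (e \in \bigcup_(v in S) star v) = ((sval e).1 \in S) || ((sval e).2 \in S).
Proof.
apply/bigcupP/orP => [[v vS]|[] eS].
- by rewrite !inE => /orP[] /eqP <-; [left|right].
- by exists (sval e).1; rewrite // !inE eqxx.
- by exists (sval e).2; rewrite // !inE eqxx orbT.
Qed.

Lemma independent_sub S S' : S' \subset S -> independent S -> independent S'.
Proof.
move=> /subsetP sub /forallP indS; apply/forallP => e; apply: contra (indS e).
by case/andP=> /sub -> /sub ->.
Qed.

Lemma star_disjoint S : independent S ->
  {in S &, forall u v, u != v -> [disjoint star u & star v]}.
Proof.
move=> /forallP indS u v uS vS uv; apply/pred0P => e /=; apply/negP.
rewrite !inE => /andP[/orP[] /eqP eu /orP[] /eqP ev].
- by rewrite eu ev eqxx in uv.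
- by have := indS e; rewrite -eu -ev uS vS.
- by have := indS e; rewrite -eu -ev uS vS.
- by rewrite eu ev eqxx in uv.
Qed.

Lemma observeK x : involutive (@observe n G x).
Proof. by move=> z; apply/ffunP => e; rewrite !ffunE addKb. Qed.

Lemma observe_flip_all x z : observe (flip_all x) z = observe x z.
Proof. by apply/ffunP => e; rewrite !ffunE; do 2 case: (x _). Qed.

Lemma observe_erase S x y : independent S ->
  observe x y =
  flip (\bigcup_(v in [set v in S | x v]) star v) (observe (erase S x) y).
Proof.
move=> /forallP indS; apply/ffunP => e; rewrite !ffunE in_bigcup_star !inE addbA.
have := indS e.
by case: (_ \in S); case: (_ \in S); case: (x _); case: (x _).
Qed.

Section Likelihood.
Variables (R : realFieldType) (eps : R).
Hypotheses (eps01 : 0 < eps < 1) (eps_half : eps <= 2^-1).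

Definition likelihood_bound S w : R :=
  product_law (noise eps) w * \prod_(v in S) flip_gain eps (star v) w.

Lemma product_law_observe_le S x y : independent S ->
  product_law (noise eps) (observe x y) <=
  likelihood_bound S (observe (erase S x) y).
Proof.
move=> indS; rewrite (observe_erase _ _ indS) product_law_flip //.
rewrite ler_pM2l ?product_law_noise_gt0 //.
rewrite likelihood_ratio_bigcup; last first.
  apply/star_disjoint/(independent_sub _ indS).
  by apply/subsetP => v /setIdP[].
rewrite (eq_bigl (fun v => (v \in S) && x v)) => [|v]; last by rewrite inE.
rewrite big_mkcondr; apply: ler_prod => v _; rewrite le_max.
by case: (x v); rewrite ?lexx ?orbT ?ler01 // ltW ?likelihood_ratio_gt0.
Qed.

Lemma sum_observe_erase_le S (f : {ffun edge G -> bool} -> {ffun 'I_n -> bool})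
    (h : {ffun edge G -> bool} -> R) :
  (forall w, 0 <= h w) ->
  \sum_y h (observe (erase S (f y)) y) <= 2 ^+ (n - #|S|) * \sum_w h w.
Proof.
move=> h0; pose off := pffun_on false (mem (~: S)) (mem {: bool}).
have erase_off x : erase S x \in off.
  apply/pffun_onP; split=> //; apply/supportP => v.
  by rewrite inE negbK ffunE => ->.
apply: (@le_trans _ _ (\sum_y \sum_(a in off) h (observe a y))).
  apply: ler_sum => y _; rewrite (bigD1 (erase S (f y))) //= lerDl.
  exact: sumr_ge0.
rewrite exchange_big /= (eq_bigr (fun=> \sum_w h w)) => [|a _]; last first.
  by rewrite [RHS](reindex_inj (inv_inj (observeK a))).
rewrite sumr_const card_pffun_on cardsCs setCK card_ord card_bool.
by rewrite -[_ *+ _]mulr_natl natrX.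
Qed.

Lemma sum_decoded_likelihood_le S
    (f : {ffun edge G -> bool} -> {ffun 'I_n -> bool}) : independent S ->
  \sum_y product_law (noise eps) (observe (f y) y) <=
  2 ^+ n * \prod_(v in S) (1 - tie_prob eps #|star v| / 2).
Proof.
move=> indS; have bound_ge0 w : 0 <= likelihood_bound S w.
  rewrite mulr_ge0 ?ltW ?product_law_noise_gt0 // prodr_gt0 // => v _.
  by rewrite lt_max ltr01.
apply: le_trans (ler_sum _ (fun y _ => product_law_observe_le (f y) y indS)) _.
apply: le_trans (sum_observe_erase_le S f bound_ge0) _.
have Sn : (#|S| <= n)%N by rewrite -[leqRHS]card_ord max_card.
rewrite -[X in 2 ^+ X * \prod_(_ in _) _](subnK Sn) exprD -mulrA -prodr_const.
rewrite -big_split ler_pM2l ?exprn_gt0 ?ltr0n //=.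
have -> : \sum_w likelihood_bound S w =
    \prod_(v in S) expectation (noise eps) (flip_gain eps (star v)).
  apply: (expectation_prod (sum_noise eps) (star_disjoint indS)) => v y z yz.
  by congr Num.max; apply: eq_bigr => e /yz ->.
apply: ler_prod => v _.
rewrite (le_trans ler01) ?expectation_flip_gain_ge1 //=.
rewrite mulrBr mulr1 [2 * _]mulrC divfK ?pnatr_eq0 //.
exact: expectation_flip_gain_le.
Qed.

End Likelihood.

Section Success.
Variables (eps : R) (dec : {ffun edge G -> bool} -> {ffun 'I_n -> bool}).

Lemma success_probE : success_prob eps dec =
  \sum_x \sum_z 2^-1 ^+ n * product_law (noise eps) z *
    ((dec (observe x z) == x) || (dec (observe x z) == flip_all x))%:R.
Proof.
apply: eq_bigr => x _; apply: eq_bigr => z _; rewrite !RealsE.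
by case: ifP.
Qed.

Lemma sum_correct_decoding :
  \sum_x \sum_z product_law (noise eps) z * (dec (observe x z) == x)%:R =
  \sum_y product_law (noise eps) (observe (dec y) y).
Proof.
under eq_bigr => x _ do rewrite (reindex_inj (inv_inj (observeK x))).
rewrite exchange_big; apply: eq_bigr => y _ /=.
rewrite (bigD1 (dec y)) //= big1 => [|x /negbTE xy]; rewrite observeK.
  by rewrite eqxx mulr1 addr0.
by rewrite eq_sym xy mulr0.
Qed.

Hypotheses (eps01 : 0 < eps < 1) (eps_half : eps <= 2^-1).

Lemma success_prob_le_decoded :
  success_prob eps dec <=
  2^-1 ^+ n * (2 * \sum_y product_law (noise eps) (observe (dec y) y)).
Proof.
pose correct x :=
  \sum_z product_law (noise eps) z * (dec (observe x z) == x)%:R.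
have flip_allK : involutive (@flip_all n).
  by move=> x; apply/ffunP => i; rewrite !ffunE negbK.
have -> : 2 * \sum_y product_law (noise eps) (observe (dec y) y) =
    \sum_x (correct x + correct (flip_all x)).
  rewrite big_split /= [X in _ + X](_ : _ = \sum_x correct x).
    by rewrite sum_correct_decoding -mulr2n mulr_natl.
  by rewrite [RHS](reindex_inj (inv_inj flip_allK)).
rewrite success_probE mulr_sumr; apply: ler_sum => x _.
rewrite -big_split mulr_sumr; apply: ler_sum => z _ /=.
rewrite -mulrA ler_pM2l ?exprn_gt0 ?invr_gt0 // observe_flip_all -mulrDr.
by rewrite ler_pM2l ?product_law_noise_gt0 // -natrD ler_nat; do 2 case: eqP.
Qed.

Lemma success_prob_le S : independent S ->
  success_prob eps dec <= 2 * \prod_(v in S) (1 - tie_prob eps #|star v| / 2).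
Proof.
move=> indS; apply: le_trans success_prob_le_decoded _.
have pow2_gt0 : 0 < 2 ^+ n :> R by rewrite exprn_gt0.
rewrite mulrCA ler_pM2l // exprVn -[leRHS](mulKf (lt0r_neq0 pow2_gt0)).
by rewrite ler_pM2l ?invr_gt0 ?sum_decoded_likelihood_le.
Qed.

End Success.

End IndependentSets.

(** * The probability of a tie *)

Lemma central_binomial_rec m :
  (m.+1 * 'C(m.+1.*2, m.+1) = 2 * (m.*2.+1 * 'C(m.*2, m)))%N.
Proof.
have sub : (m.*2.+1 - m = m.+1)%N by rewrite -addnn -addSn addnK.
have -> : ('C(m.+1.*2, m.+1) = 2 * 'C(m.*2.+1, m))%N.
  rewrite doubleS binS -(@bin_sub _ m.+1) ?ltnS -?addnn ?leq_addr //.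
  by rewrite subSS addnK addnn -mul2n.
by have := mul_bin_down m.*2.+1 m; rewrite /= sub => ->; rewrite mulnCA.
Qed.

Lemma central_binomial_ge m : (16 ^ m <= 'C(m.*2, m) ^ 2 * (4 * m).+1)%N.
Proof.
elim: m => [|m IHm]; first by rewrite bin0.
rewrite -(leq_pmul2l (_ : 0 < m.+1 ^ 2)%N) ?expn_gt0 // mulnA -expnMn.
rewrite central_binomial_rec (expnS 16); set b := 'C(m.*2, m) in IHm *.
apply: (@leq_trans (m.+1 ^ 2 * (16 * (b ^ 2 * (4 * m).+1)))).
  by rewrite !leq_mul2l IHm !orbT.
have -> : ((2 * (m.*2.+1 * b)) ^ 2 * (4 * m.+1).+1 =
    m.+1 ^ 2 * (16 * (b ^ 2 * (4 * m).+1)) + 4 * b ^ 2)%N.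
  by rewrite -mul2n; ring.
exact: leq_addr.
Qed.

Lemma central_binomial_uphalf k :
  ('C((uphalf k).*2, uphalf k) <= 2 * 'C(k, uphalf k))%N.
Proof.
rewrite uphalf_half; move: (odd_double_half k).
move: (odd k) (k./2) => [] m <-; last first.
  by rewrite !add0n mul2n -[leqRHS]addnn leq_addr.
rewrite !add1n doubleS binS.
rewrite -(@bin_sub _ m.+1) ?ltnS -?addnn ?leq_addr //.
by rewrite subSS addnK mul2n -addnn.
Qed.

Lemma tie_prob_ge (R : rcfType) (eps : R) k : 0 <= eps <= 1 ->
  (4 * (eps * (1 - eps))) ^+ uphalf k / (2 * Num.sqrt (4 * (uphalf k)%:R + 1)) <=
  tie_prob eps k.
Proof.
case/andP=> eps0; rewrite -subr_ge0 => epsC0; rewrite /tie_prob.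
set m := uphalf k; set s := Num.sqrt _; pose b : R := 'C(m.*2, m)%:R.
have kmm : (k - m <= m)%N by rewrite leq_subLR addnn uphalfK leq_addl.
have s0 : 0 < s by rewrite sqrtr_gt0 ltr_wpDl // mulr_ge0.
have bs : 4 ^+ m <= b * s.
  rewrite -ler_sqr ?nnegrE ?exprn_ge0 ?(mulr_ge0 _ (ltW s0)) // exprMn sqr_sqrtr.
    rewrite -exprM mulnC exprM -!natrX -natrM natr1 -natrM ler_nat.
    exact: central_binomial_ge.
  by rewrite addr_ge0 ?mulr_ge0.
have bC : b <= 2 * 'C(k, m)%:R by rewrite -natrM ler_nat central_binomial_uphalf.
have pow_le : (eps * (1 - eps)) ^+ m <= eps ^+ m * (1 - eps) ^+ (k - m).
  rewrite exprMn ler_wpM2l ?exprn_ge0 // ler_wiXn2l //.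
  by rewrite lerBlDr lerDl.
rewrite ler_pdivrMr ?mulr_gt0 // exprMn -[_ *+ 'C(k, m)]mulr_natl.
rewrite [leRHS](_ : _ =
  2 * 'C(k, m)%:R * s * (eps ^+ m * (1 - eps) ^+ (k - m))); last by ring.
rewrite ler_pM ?exprn_ge0 ?mulr_ge0 //.
by rewrite (le_trans bs) // ler_pM2r.
Qed.

Lemma KL_halfE eps : 0 < eps < 1 ->
  KL_half eps = - ln (4 * (eps * (1 - eps))) / 2.
Proof.
rewrite -(subr_gt0 eps) => /andP[eps0 epsC0]; rewrite /KL_half !RealsE /=.
have -> : 4 * (eps * (1 - eps)) = (2 * eps) * (2 * (1 - eps)) by ring.
by rewrite lnM ?lnV ?posrE ?mulr_gt0 //; lra.
Qed.

Lemma expR_KL_half eps : 0 < eps < 1 ->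
  expR (- (2 * KL_half eps)) = 4 * (eps * (1 - eps)).
Proof.
move=> /[dup] /KL_halfE ->; rewrite -(subr_gt0 eps) => /andP[eps0 epsC0].
by rewrite mulrC divfK ?pnatr_eq0 // opprK lnK // posrE !mulr_gt0.
Qed.

Lemma KL_half_gt0 eps : 0 < eps < 2^-1 -> 0 < KL_half eps.
Proof.
move=> eps_range; rewrite KL_halfE; last by lra.
by rewrite divr_gt0 // oppr_gt0 ln_lt0 //; nra.
Qed.

Lemma KL_half_le eps : 0 < eps < 2^-1 ->
  2 * KL_half eps * (1 - (1 - 2 * eps) ^+ 2) <= (1 - 2 * eps) ^+ 2.
Proof.
move=> eps_range.
have uE : 1 - (1 - 2 * eps) ^+ 2 = expR (- (2 * KL_half eps)).
  by rewrite expR_KL_half; [ring | lra].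
have : (1 + 2 * KL_half eps) * expR (- (2 * KL_half eps)) <= 1.
  rewrite -[leRHS](expRxMexpNx_1 (2 * KL_half eps)).
  by rewrite ler_pM2r ?expR_gt0 ?expR_ge1Dx.
by rewrite -uE; lra.
Qed.

Lemma tie_prob_ge_expR eps k (K : R) : 0 < eps < 2^-1 -> k%:R + 1 <= K ->
  expR (- (K * KL_half eps)) / (2 * Num.sqrt (3 * K)) <= tie_prob eps k.
Proof.
move=> eps_range kK; have KL0 := KL_half_gt0 eps_range.
have eps01 : 0 < eps < 1 by lra.
apply: le_trans (tie_prob_ge _ _); last by lra.
rewrite -expR_KL_half // -expRM_natl; set m := uphalf k.
have m2k : 2 * m%:R <= k%:R + 1 :> R.
  by rewrite -natrM natr1 ler_nat mul2n uphalfK; case: (odd k).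
have m0 : 0 <= m%:R :> R by [].
have k0 : 0 <= k%:R :> R by [].
rewrite ler_pM ?expR_ge0 ?invr_ge0 ?mulr_ge0 ?sqrtr_ge0 //.
  by rewrite ler_expR; nra.
by rewrite lef_pV2 ?posrE ?mulr_gt0 ?sqrtr_gt0 ?ler_pM2l ?ler_wsqrtr //; lra.
Qed.

(** * Low-degree independent sets *)

Lemma leq_card_bigcup (I T : finType) (A : {set I}) (F : I -> {set T}) :
  (#|\bigcup_(i in A) F i| <= \sum_(i in A) #|F i|)%N.
Proof.
elim/big_rec2: _ => [|i k B _ leBk]; first by rewrite cards0.
by rewrite (leq_trans (leq_card_setU _ _)) ?leq_add2l.
Qed.

Section Degrees.
Variables (n : nat) (G : rel 'I_n).

Lemma handshake : (\sum_(v < n) #|star G v| = 2 * num_edges G)%N.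
Proof.
under eq_bigr do rewrite -sum1_card big_mkcond /=.
rewrite exchange_big /= mulnC /num_edges -sum_nat_const; apply: eq_bigr => e _.
rewrite -big_mkcond -[RHS](_ : #|[set (sval e).1; (sval e).2]| = 2)%N.
  by rewrite -sum1_card; apply: eq_bigl => v; rewrite inE.
by rewrite cards2 edge_neq.
Qed.

(* A vertex of W outside a maximal S is determined by an edge joining it to S. *)
Lemma exists_independent (W : {set 'I_n}) :
  exists2 S : {set 'I_n}, independent G S && (S \subset W) &
    (#|W| <= \sum_(v in S) #|star G v|.+1)%N.
Proof.
have ind0 : independent G set0 && (set0 \subset W).
  by rewrite sub0set andbT; apply/forallP => e; rewrite inE.
have [S /maxsetP[/andP[indS SW] maxS] _] :=
  maxset_exists (P := fun S => independent G S && (S \subset W)) ind0.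
exists S; first by rewrite indS.
pose outer (e : edge G) := if (sval e).1 \in S then (sval e).2 else (sval e).1.
have WS : W :\: S \subset outer @: \bigcup_(v in S) star G v.
  apply/subsetP => w /setDP[wW wS].
  have /forallPn[e] : ~~ independent G (w |: S).
    apply: contra wS => ind; rewrite -(maxS (w |: S)) ?setU11 ?subsetUr //.
    by rewrite ind subUset sub1set wW.
  rewrite negbK !inE => /andP[ew1 ew2]; have /forallP/(_ e) := indS.
  case: (boolP ((sval e).1 \in S)) => [e1S /= /negbTE e2S|/negbTE e1S _].
    move: ew2; rewrite e2S orbF => /eqP <-.
    by apply/imsetP; exists e; rewrite ?in_bigcup_star /outer e1S.
  move: ew1 ew2; rewrite e1S orbF => /eqP <-.
  rewrite eq_sym (negbTE (edge_neq e)) /= => e2S.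
  by apply/imsetP; exists e; rewrite ?in_bigcup_star /outer e1S // e2S.
under eq_bigr do rewrite -addn1; rewrite big_split /= sum1_card addnC.
rewrite -(cardsID S W) (setIidPr SW) leq_add2l.
apply: leq_trans (subset_leq_card WS) _.
exact: leq_trans (leq_imset_card _ _) (leq_card_bigcup _ _).
Qed.

Lemma exists_low_degree_independent (F : realFieldType) (K : F) : 0 < K ->
  exists2 S : {set 'I_n}, independent G S &
    {in S, forall v, #|star G v|%:R + 1 <= K} /\
    n%:R * K - (2 * num_edges G + n)%:R <= K * (K * #|S|%:R).
Proof.
move=> K0; pose W := [set v | #|star G v|%:R + 1 <= K].
have [S /andP[indS /subsetP SW] WS] := exists_independent W.
have lowS : {in S, forall v, #|star G v|%:R + 1 <= K}.
  by move=> v /SW; rewrite inE.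
exists S => //; split=> //.
have WKS : #|W|%:R <= K * #|S|%:R.
  apply: (@le_trans _ _ (\sum_(v in S) #|star G v|.+1)%:R).
    by rewrite ler_nat.
  rewrite natr_sum mulr_natr -sumr_const; apply: ler_sum => v vS.
  by rewrite -natr1 lowS.
have markov : #|~: W|%:R * K <= (2 * num_edges G + n)%:R.
  have -> : (2 * num_edges G + n)%:R = \sum_(v < n) (#|star G v|%:R + 1) :> F.
    by rewrite big_split /= sumr_const card_ord -natr_sum handshake natrD.
  rewrite mulr_natl -sumr_const [leLHS]big_mkcond; apply: ler_sum => v _.
  by rewrite !inE; case: (leP (_ + 1) K) => /= [_|/ltW //]; rewrite addr_ge0.
have -> : n%:R = #|W|%:R + #|~: W|%:R :> F by rewrite -natrD cardsC card_ord.
have WKS_K : #|W|%:R * K <= K * #|S|%:R * K by rewrite ler_wpM2r // ltW.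
by lra.
Qed.

End Degrees.

(** * The degree forced by recovery *)

Lemma avg_degreeE n (G : rel 'I_n) :
  avg_degree G = (2 * num_edges G)%:R / n%:R.
Proof. by rewrite /avg_degree !RealsE natrM. Qed.

Lemma avg_degree_ge0 n (G : rel 'I_n) : 0 <= avg_degree G.
Proof. by rewrite avg_degreeE divr_ge0. Qed.

Lemma prodr_le_expR (R : realType) (I : finType) (A : {set I}) (c : I -> R) :
  (forall i, i \in A -> c i <= 1) ->
  \prod_(i in A) (1 - c i) <= expR (- \sum_(i in A) c i).
Proof.
move=> c1; rewrite -sumrN expR_sum; apply: ler_prod => i iA.
by rewrite subr_ge0 c1 // expR_ge1Dx.
Qed.

Section SuccessfulDecoder.
Variables (n : nat) (G : rel 'I_n) (eps : R).
Variable dec : {ffun edge G -> bool} -> {ffun 'I_n -> bool}.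
Hypotheses (n_gt0 : (0 < n)%N) (eps_range : 0 < eps < 2^-1).
Hypothesis success : 2 * expR (- 1) < success_prob eps dec.

Lemma sum_tie_prob_lt2 S : independent G S ->
  \sum_(v in S) tie_prob eps #|star G v| < 2.
Proof.
have eps01 : 0 < eps < 1 by move: eps_range; lra.
have eps_half : eps <= 2^-1 by move: eps_range; lra.
move=> /(success_prob_le dec eps01 eps_half) /(lt_le_trans success).
rewrite ltr_pM2l // => /lt_le_trans lt_expR.
have /lt_expR : \prod_(v in S) (1 - tie_prob eps #|star G v| / 2) <=
    expR (- \sum_(v in S) tie_prob eps #|star G v| / 2).
  apply: prodr_le_expR => v _.
  by have := tie_prob_le1 #|star G v| eps01; lra.
by rewrite ltr_expR ltrN2 -mulr_suml ltr_pdivrMr ?mul1r.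
Qed.

Lemma graph_order_lt (K : R) : avg_degree G + 1 < K ->
  n%:R * (K - (avg_degree G + 1)) <
  K ^+ 2 * (4 * Num.sqrt (3 * K) * expR (K * KL_half eps)).
Proof.
have d0 := avg_degree_ge0 G => dK; have K0 : 0 < K by lra.
have [S indS [lowS sizeS]] := exists_low_degree_independent G K0.
have -> : n%:R * (K - (avg_degree G + 1)) = n%:R * K - (2 * num_edges G + n)%:R.
  rewrite avg_degreeE natrD mulrBr mulrDr mulr1 mulrCA.
  by rewrite divff ?mulr1 ?pnatr_eq0 -?lt0n.
apply: le_lt_trans sizeS _; rewrite mulrA ltr_pM2l ?mulr_gt0 //.
set s := Num.sqrt _; have s0 : 0 < s by rewrite sqrtr_gt0 mulr_gt0.
have := sum_tie_prob_lt2 indS; apply: contraTT; rewrite -!leNgt => cardS.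
apply: (@le_trans _ _ (\sum_(v in S) (expR (- (K * KL_half eps)) / (2 * s)))).
  rewrite sumr_const -[_ *+ #|S|]mulr_natl expRN -invfM.
  rewrite ler_pdivlMr ?mulr_gt0 ?expR_gt0 //.
  by apply: le_trans cardS; lra.
by apply: ler_sum => v vS; apply: tie_prob_ge_expR; rewrite ?lowS.
Qed.

Lemma ln_graph_order_le (K c : R) :
  0 < K -> 0 < c -> avg_degree G + 1 <= (1 - c) * K ->
  ln n%:R <= K * KL_half eps + 3 / 2 * ln K + ln (4 * Num.sqrt 3 / c).
Proof.
move=> K0 c0 slack; have d0 := avg_degree_ge0 G.
have cK0 : 0 < c * K by rewrite mulr_gt0.
have sqrtK0 : 0 < Num.sqrt K by rewrite sqrtr_gt0.
have C0 : 0 < 4 * Num.sqrt 3 / c :> R by rewrite divr_gt0 ?mulr_gt0 ?sqrtr_gt0.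
have E0 := expR_gt0 (K * KL_half eps).
have order_le : n%:R <=
    4 * Num.sqrt 3 / c * (K * Num.sqrt K) * expR (K * KL_half eps).
  rewrite -(ler_pM2r cK0).
  apply: (@le_trans _ _ (n%:R * (K - (avg_degree G + 1)))).
    by rewrite ler_wpM2l //; lra.
  apply: le_trans (ltW (graph_order_lt _)) _; first by lra.
  rewrite sqrtrM // [leRHS](_ : _ =
    K ^+ 2 * (4 * (Num.sqrt 3 * Num.sqrt K) * expR (K * KL_half eps))) //.
  by field; rewrite gt_eqF.
have ln_sqrtK : ln (Num.sqrt K) = ln K / 2.
  by rewrite -[in RHS](sqr_sqrtr (ltW K0)) lnXn // mulr2n; field.
move: (4 * _ / c) C0 order_le => C C0 order_le.
rewrite -ler_ln ?posrE ?ltr0n ?mulr_gt0 // in order_le.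
apply: le_trans order_le _; rewrite !lnM ?posrE ?mulr_gt0 // expRK ln_sqrtK.
by lra.
Qed.

Lemma sparse_ln_graph_order_le (eta tau : R) :
  0 < eta -> 0 <= tau -> avg_degree G <= n%:R `^ tau ->
  (1 - 3 * tau / 2) * ln n%:R <= (1 + eta) * ((avg_degree G + 1) * KL_half eps) +
    3 / 2 * ln (2 * (1 + eta)) + ln (4 * Num.sqrt 3 / (eta / (1 + eta))).
Proof.
move=> eta0 tau0 sparse; have d0 := avg_degree_ge0 G.
pose K := (1 + eta) * (avg_degree G + 1).
have K0 : 0 < K by rewrite mulr_gt0 //; lra.
have c0 : 0 < eta / (1 + eta) by rewrite divr_gt0 //; lra.
have slack : (1 - eta / (1 + eta)) * K = avg_degree G + 1.
  by rewrite /K; field; lra.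
have n1 : 1 <= n%:R :> R by rewrite ler1n.
have ln_K_le : ln K <= ln (2 * (1 + eta)) + tau * ln n%:R.
  have eta2 : 0 < 2 * (1 + eta) by lra.
  have pow0 : 0 < n%:R `^ tau by rewrite powR_gt0 ?ltr0n.
  rewrite -ln_powR -lnM ?posrE // ler_ln ?posrE ?(mulr_gt0 eta2 pow0) //.
  by have := ler_powR n1 tau0; rewrite powRr0 /K; nra.
have := ln_graph_order_le K0 c0; rewrite slack lexx => /(_ isT).
by rewrite /K -mulrA; lra.
Qed.

End SuccessfulDecoder.

(** * Asymptotics *)

Local Open Scope classical_set_scope.
Local Open Scope ring_scope.

Lemma near_ln_ge (R : realType) (M : R) : \forall n \near \oo, M <= ln n%:R.
Proof.
near=> n; have expM : expR M <= n%:R by near: n; exact: nbhs_infty_ger.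
by rewrite -[M]expRK ler_ln ?posrE ?expR_gt0 // (lt_le_trans _ expM) ?expR_gt0.
Unshelve. all: by end_near. Qed.

Lemma Un_cvP (u : nat -> R) (l : R) :
  Un_cv u l <-> forall e : R, 0 < e -> \forall n \near \oo, `|u n - l| < e.
Proof.
split=> cv e /RltP e0.
  have [N uN] := cv e e0; exists N => // n /ssrnat.leP /uN /RltP.
  by rewrite RdistE.
have [N _ uN] := cv e e0; exists N => n /ssrnat.leP /uN /= near_n.
by apply/RltP; rewrite RdistE.
Qed.

(* Num.min 0 (f n - g n) is the largest admissible error term. *)
Lemma exists_error_term (f g w : nat -> R) :
  (forall n, 0 < w n) ->
  (forall delta : R, 0 < delta ->
     \forall n \near \oo, - delta <= (f n - g n) * w n) ->
  exists2 r : nat -> R, Un_cv (fun n => r n * w n) 0 & forall n, g n + r n <= f n.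
Proof.
move=> w0 fg; exists (fun n => Num.min 0 (f n - g n)) => [|n]; last first.
  by rewrite -lerBrDl ge_min lexx orbT.
apply/Un_cvP => e e0; near=> n.
have fgn : - (e / 2) <= (f n - g n) * w n by near: n; apply: fg; lra.
rewrite subr0 ltr_norml minElt; have := w0 n.
by case: (ltP 0 (f n - g n)) => [_|neg] wn; [lra | nra].
Unshelve. all: by end_near. Qed.

Section Sequences.
Variables (G : forall n, rel 'I_n) (eps : nat -> R) (tau : R).
Arguments G : clear implicits.
Hypotheses (eps_range : forall n, 0 < eps n < 2^-1) (tau_range : 0 < tau < 2 / 3).
Hypothesis sparse : forall n, (0 < n)%N -> avg_degree (G n) <= n%:R `^ tau.
Hypothesis recovery : exact_recovery_whp G eps.

Lemma near_avg_degree_ge (delta : R) : 0 < delta ->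
  \forall n \near \oo, (1 - 3 * tau / 2 - delta) * ln n%:R <=
    (avg_degree (G n) + 1) * KL_half (eps n).
Proof.
move=> delta0; have [dec /Un_cvP success] := recovery.
have gap : 0 < 1 - 2 * expR (- 1) :> R.
  by rewrite expRN subr_gt0 ltr_pdivrMr ?expR_gt0 // mul1r expR_gt1Dx ?oner_eq0.
pose eta := delta / 2; have eta0 : 0 < eta by rewrite divr_gt0.
have tau0 : 0 <= tau by move: tau_range; lra.
set C := 3 / 2 * ln (2 * (1 + eta)) + ln (4 * Num.sqrt 3 / (eta / (1 + eta))).
near=> n.
have n0 : (0 < n)%N by near: n; exact: nbhs_infty_gt.
have success_n : 2 * expR (- 1) < success_prob (eps n) (dec n).
  have : `|success_prob (eps n) (dec n) - 1| < 1 - 2 * expR (- 1).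
    by near: n; exact: success.
  by rewrite ltr_norml; lra.
have ln0 : 0 <= ln n%:R :> R by near: n; exact: near_ln_ge.
have lnC : C <= eta * ln n%:R.
  by rewrite -ler_pdivrMl //; near: n; exact: near_ln_ge.
have := sparse_ln_graph_order_le n0 (eps_range n) success_n eta0 tau0 (sparse n0).
rewrite -addrA -/C => bound.
have slack : 0 <= eta * (3 * tau / 2 + delta) * ln n%:R.
  by rewrite mulr_ge0 // mulr_ge0 ?(ltW eta0) //; lra.
rewrite -(ler_pM2l (_ : 0 < 1 + eta)); last by lra.
by rewrite /eta in slack lnC bound *; lra.
Unshelve. all: by end_near. Qed.

Lemma near_avg_degree_ge_weak_noise (delta : R) : Un_cv eps 2^-1 -> 0 < delta ->
  \forall n \near \oo, (2 * (1 - 3 * tau / 2) - delta) * ln n%:R <=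
    avg_degree (G n) * (1 - 2 * eps n) ^+ 2.
Proof.
move=> /Un_cvP eps_cv delta0; near=> n.
have d1 : 0 <= avg_degree (G n) + 1 by rewrite addr_ge0 ?avg_degree_ge0.
have eps_n := eps_range n; have KL_le := KL_half_le eps_n.
have l1 : 1 <= ln n%:R :> R by near: n; exact: near_ln_ge.
have bound : (1 - 3 * tau / 2 - delta / 4) * ln n%:R <=
    (avg_degree (G n) + 1) * KL_half (eps n).
  by near: n; apply: near_avg_degree_ge; rewrite divr_gt0.
have close : 2^-1 - eps n < delta / 24.
  have : `|eps n - 2^-1| < delta / 24 by near: n; apply: eps_cv; rewrite divr_gt0.
  by rewrite ltr_norml; lra.
set l := ln n%:R in l1 bound *; set u := (1 - 2 * eps n) ^+ 2 in KL_le *.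
have [u0 u_lt1 u_small] : [/\ 0 <= u, u < 1 & u <= delta / 12].
  by rewrite /u; split; nra.
have boundM : 2 * ((1 - 3 * tau / 2 - delta / 4) * l) * (1 - u) <=
    (avg_degree (G n) + 1) * u.
  apply: (@le_trans _ _
    (2 * ((avg_degree (G n) + 1) * KL_half (eps n)) * (1 - u))).
    by rewrite ler_wpM2r ?ler_wpM2l // subr_ge0 ltW.
  by have := ler_wpM2l d1 KL_le; lra.
have lu : u <= l * u by rewrite ler_peMl.
have lu_small : l * u <= l * (delta / 12) by rewrite ler_wpM2l //; lra.
have loss : 0 <= (3 * tau / 2 + delta / 4) * (l * u).
  by rewrite mulr_ge0 ?(le_trans u0 lu) //; move: tau_range; lra.
by lra.
Unshelve. all: by end_near. Qed.

Lemma avg_degree_ge :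
  exists2 r : nat -> R, Un_cv (fun n => r n * KL_half (eps n)) 0 &
    forall n, (1 - 3 * tau / 2) / KL_half (eps n) - 1 / ln n%:R + r n <=
      avg_degree (G n) / ln n%:R.
Proof.
apply: exists_error_term => [n|delta delta0]; first exact: KL_half_gt0.
near=> n; have KL0 := KL_half_gt0 (eps_range n).
have : (1 - 3 * tau / 2 - delta) * ln n%:R <=
    (avg_degree (G n) + 1) * KL_half (eps n).
  by near: n; exact: near_avg_degree_ge.
have : 1 <= ln n%:R :> R by near: n; exact: near_ln_ge.
set l := ln _; set d := avg_degree _; set D := KL_half _ in KL0 * => l1 bound.
have -> : (d / l - ((1 - 3 * tau / 2) / D - 1 / l)) * D =
  ((d + 1) * D - (1 - 3 * tau / 2) * l) / l by field; lra.
by rewrite ler_pdivlMr; lra.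
Unshelve. all: by end_near. Qed.

Lemma avg_degree_ge_weak_noise : Un_cv eps 2^-1 ->
  exists2 r : nat -> R, Un_cv (fun n => r n * (1 - 2 * eps n) ^+ 2) 0 &
    forall n, 2 * (1 - 3 * tau / 2) / (1 - 2 * eps n) ^+ 2 + r n <=
      avg_degree (G n) / ln n%:R.
Proof.
move=> eps_cv; have u_gt0 n : 0 < (1 - 2 * eps n) ^+ 2.
  by rewrite exprn_gt0 //; have := eps_range n; lra.
apply: exists_error_term => // delta delta0; near=> n; have u0 := u_gt0 n.
have : (2 * (1 - 3 * tau / 2) - delta) * ln n%:R <=
    avg_degree (G n) * (1 - 2 * eps n) ^+ 2.
  by near: n; exact: near_avg_degree_ge_weak_noise.
have : 1 <= ln n%:R :> R by near: n; exact: near_ln_ge.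
set l := ln _; set d := avg_degree _; set u := (_ ^+ 2) in u0 * => l1 bound.
have -> : (d / l - 2 * (1 - 3 * tau / 2) / u) * u =
  (d * u - 2 * (1 - 3 * tau / 2) * l) / l by field; lra.
by rewrite ler_pdivlMr; lra.
Unshelve. all: by end_near. Qed.

End Sequences.

Lemma Rlt2P (x y z : R) : reflect (Rlt x y /\ Rlt y z) (x < y < z).
Proof. by apply: (iffP andP) => -[/RltP xy /RltP yz]. Qed.

Lemma RpowerE (x y : R) : 0 < x -> Rpower x y = x `^ y.
Proof. by move=> x0; rewrite /Rpower !RealsE /powR gt_eqF. Qed.

(* From here on [ln] is the logarithm of Stdlib again. *)
Import Rpower.
Open Scope R_scope.

Theorem theorem1 (G : forall n : nat, rel 'I_n) (eps : nat -> R) (tau : R) :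
  (forall n, simple_graph (G n)) ->
  (forall n, 0 < eps n < / 2) ->
  0 < tau < 2 / 3 ->
  (forall n, (0 < n)%nat -> avg_degree (G n) <= Rpower (INR n) tau) ->
  exact_recovery_whp G eps ->
  (exists r : nat -> R,
     Un_cv (fun n => r n * KL_half (eps n)) 0 /\
     exists N : nat, forall n : nat, (N <= n)%nat ->
       avg_degree (G n) / ln (INR n) >=
       (1 - 3 * tau / 2) / KL_half (eps n) - 1 / ln (INR n) + r n)
  /\
  (Un_cv eps (/ 2) ->
   exists r : nat -> R,
     Un_cv (fun n => r n * (1 - 2 * eps n) ^ 2) 0 /\
     exists N : nat, forall n : nat, (N <= n)%nat ->
       avg_degree (G n) / ln (INR n) >=
       2 * (1 - 3 * tau / 2) / (1 - 2 * eps n) ^ 2 + r n).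
Proof.
move=> _ eps_lt tau_lt sparse_Rpower recovery.
have eps_range n : (0 < eps n < 2^-1)%R by exact/Rlt2P.
have tau_range : (0 < tau < 2 / 3)%R by rewrite -RdivE; exact/Rlt2P.
have sparse n : (0 < n)%N -> (avg_degree (G n) <= n%:R `^ tau)%R.
  by move=> n0; rewrite -RpowerE ?ltr0n // -INRE; apply/RleP/sparse_Rpower.
split=> [|eps_cv].
  have [r r0 r_le] := avg_degree_ge eps_range tau_range sparse recovery.
  exists r; split=> //; exists 0%N => n _.
  by apply/Rle_ge/RleP; rewrite !RealsE; exact: r_le.
have [r r0 r_le] :=
  avg_degree_ge_weak_noise eps_range tau_range sparse recovery eps_cv.
exists r; split; first by apply: Un_cv_ext r0 => n; rewrite !RealsE.
by exists 0%N => n _; apply/Rle_ge/RleP; rewrite !RealsE; exact: r_le.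
Qed.
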